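(* Let $D$ be a nonempty open set in a metric space $(X,\rho)$ and let $\partial D\neq\varnothing$. Then for every real $c\geq 2$ the function $$h_{D,c}(x,y)=\log\left(1+c\,\frac{\rho(x,y)}{\sqrt{d_D(x)\,d_D(y)}}\right),\qquad x,y\in D,$$ where $d_D(x)=\operatorname{dist}(x,\partial D)$, is a metric on $D$. The constant $2$ is best possible: for every $c\in(0,2)$ there exist a metric space $(X,\rho)$ and a nonempty open set $D\subseteq X$ with $\partial D\neq\varnothing$ such that $h_{D,c}$ is not a metric on $D$.
   Context: Here $\partial D$ is the topological boundary of $D$ in $X$, and $\operatorname{dist}(x,A)=\inf_{a\in A}\rho(x,a)$. *)

(* Defs.v *)
From mathcomp Require Import all_boot all_order all_algebra.
From mathcomp Require Import all_classical all_reals all_analysis.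

Set Implicit Arguments.
Unset Strict Implicit.
Unset Printing Implicit Defensive.

Import Order.TTheory GRing.Theory Num.Theory.

Local Open Scope classical_set_scope.
Local Open Scope ring_scope.

Definition boundary (T : topologicalType) (A : set T) : set T :=
  closure A `\` interior A.

(* [inf set0] is the junk value [0], so this is the distance to [A] only for
   nonempty [A]. *)
Definition set_dist (R : realType) (X : metricType R) (x : X) (A : set X) : R :=
  inf [set mdist x a | a in A].

Definition bdist (R : realType) (X : metricType R) (D : set X) (x : X) : R :=
  set_dist x (boundary D).

(* Meaningful for [x], [y] in [D]; it is total on [X] because [/] and
   [Num.sqrt] are, and only [is_metric_on D] is ever asserted of it. *)
Definition hdist (R : realType) (X : metricType R) (D : set X) (c : R)
    (x y : X) : R :=
  ln (1 + c * (mdist x y / Num.sqrt (bdist D x * bdist D y))).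

Definition is_metric_on (R : realType) (T : Type) (D : set T)
    (h : T -> T -> R) : Prop :=
  [/\ forall x y, D x -> D y -> 0 <= h x y,
      forall x y, D x -> D y -> (h x y = 0 <-> x = y),
      forall x y, D x -> D y -> h x y = h y x
    & forall x y z, D x -> D y -> D z -> h x z <= h x y + h y z].

(* Main.v *)
(** Write [a], [b], [e] for the distances of [x], [y], [z] to the boundary and
    [p], [q] for the distances from [x] to [y] and from [y] to [z].  After
    exponentiation the triangle inequality follows from
    [(p + q) b <= p sqrt (b e) + q sqrt (a b) + c p q], and this holds for
    [2 <= c] because [sqrt (b e) >= min b e >= b - q] and
    [sqrt (a b) >= b - p], the distance to a set being 1-Lipschitz.

    For [c < 2] the inequality fails in the interval [(-1, 1)] for the points
    [-(1 - s^2)], [0], [1 - s^2], as soon as [c (1 + s) < 2]. *)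
Require Import Defs.
From mathcomp Require Import all_boot all_order all_algebra.
From mathcomp Require Import all_classical all_reals all_analysis.
From mathcomp Require Import ring lra.

Import Order.TTheory GRing.Theory Num.Theory.
Import numFieldNormedType.Exports.

Local Open Scope classical_set_scope.
Local Open Scope ring_scope.

Section SetDist.
Context {R : realType} {X : metricType R}.
Implicit Types (x y : X) (A : set X).

Lemma set_dist_has_lbound x A : has_lbound [set mdist x a | a in A].
Proof. by exists 0 => _ [a _ <-]; exact: mdist_ge0. Qed.

Lemma set_dist_le x a A : A a -> set_dist x A <= mdist x a.
Proof.
by move=> Aa; apply: ge_inf; [exact: set_dist_has_lbound|exists a].
Qed.

Lemma le_set_dist x A r :
  A !=set0 -> (forall a, A a -> r <= mdist x a) -> r <= set_dist x A.
Proof.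
move=> [a Aa] h; apply: lb_le_inf; first by exists (mdist x a), a.
by move=> _ [b Ab <-]; exact: h.
Qed.

Lemma set_dist_lipschitz x y A :
  A !=set0 -> set_dist x A <= mdist x y + set_dist y A.
Proof.
move=> A0; rewrite -lerBlDl; apply: le_set_dist => // a Aa.
rewrite lerBlDl; apply: le_trans (metric_triangle x y a).
exact: set_dist_le.
Qed.

(** The complement of [A] is open, so it contains a ball around [x], whose radius bounds the
    distance from below. *)
Lemma set_dist_gt0 x A : closed A -> A !=set0 -> ~ A x -> 0 < set_dist x A.
Proof.
move=> cA A0 nAx.
have /nbhs_ballP[r /= r0 rA] : nbhs x (~` A).
  by apply: open_nbhs_nbhs; split => //; exact: closed_openC.
apply: (lt_le_trans r0); apply: le_set_dist => // a Aa.
by rewrite leNgt; apply/negP => xa; apply: (rA a) => //; rewrite ballEmdist.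
Qed.

End SetDist.

Lemma closed_boundary (T : topologicalType) (A : set T) : closed (boundary A).
Proof.
rewrite /boundary setDE; apply: closedI; first exact: closed_closure.
by apply: open_closedC; exact: open_interior.
Qed.

Lemma open_notin_boundary (T : topologicalType) (A : set T) (x : T) :
  open A -> A x -> ~ boundary A x.
Proof. by move=> /interior_id oA Ax; rewrite /boundary oA => -[]. Qed.

(** Here [a], [b], [e] are the square roots of the distances to the boundary. *)
Lemma hdist_expand_triangle (R : realFieldType) (c a b e p q r : R) :
  2 <= c -> 0 < a -> 0 < b -> 0 < e -> 0 <= p -> 0 <= q -> r <= p + q ->
  b ^+ 2 <= p + a ^+ 2 -> b ^+ 2 <= q + e ^+ 2 ->
  1 + c * (r / (a * e)) <= (1 + c * (p / (a * b))) * (1 + c * (q / (b * e))).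
Proof.
move=> c2 a0 b0 e0 p0 q0 rpq bpa bqe.
(* If [e <= b], then [b * e >= e ^+ 2]; otherwise the left side is negative. The same split gives
   [bp]. *)
have bq : b ^+ 2 - b * e <= q by have [] := leP e b => ?; nra.
have bp : b ^+ 2 - a * b <= p by have [] := leP a b => ?; nra.
have key : r * b ^+ 2 <= p * (b * e) + q * (a * b) + c * (p * q).
  have rb : r * b ^+ 2 <= (p + q) * b ^+ 2 by rewrite ler_wpM2r// sqr_ge0.
  have pq2 : 2 * (p * q) <= c * (p * q) by rewrite ler_wpM2r// mulr_ge0.
  (* Adding [p] times [bq] to [q] times [bp] leaves an excess of at most [2 * (p * q)], which
     [c * (p * q)] absorbs. *)
  have := ler_wpM2l p0 bq; have := ler_wpM2l q0 bp.
  lra.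
rewrite -subr_ge0.
have -> : (1 + c * (p / (a * b))) * (1 + c * (q / (b * e)))
    - (1 + c * (r / (a * e)))
  = c * ((p * (b * e) + q * (a * b) + c * (p * q) - r * b ^+ 2)
         / (a * b ^+ 2 * e)).
  by field; rewrite !gt_eqF.
apply: mulr_ge0; first lra.
by rewrite divr_ge0 ?subr_ge0// !mulr_ge0 ?sqr_ge0// ltW.
Qed.

Section HdistMetric.
Context {R : realType} {X : metricType R} {D : set X} {c : R}.
Hypotheses (oD : open D) (bD0 : boundary D !=set0) (c2 : 2 <= c).
Implicit Types x y z : X.

Let d := bdist D.

Lemma bdist_gt0 x : D x -> 0 < bdist D x.
Proof.
move=> Dx; apply: set_dist_gt0 => //; first exact: closed_boundary.
exact: open_notin_boundary.
Qed.

Let c0 : 0 < c. Proof. exact: lt_le_trans c2. Qed.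

Lemma hdist_quotient_ge0 x y : 0 <= mdist x y / Num.sqrt (d x * d y).
Proof. by rewrite divr_ge0 ?mdist_ge0 ?sqrtr_ge0. Qed.

Let arg_ge1 x y : 1 <= 1 + c * (mdist x y / Num.sqrt (d x * d y)).
Proof. by rewrite lerDl mulr_ge0 ?hdist_quotient_ge0// ltW. Qed.

Let arg_gt0 x y : 0 < 1 + c * (mdist x y / Num.sqrt (d x * d y)).
Proof. exact: lt_le_trans (arg_ge1 x y). Qed.

Lemma hdist_ge0 x y : 0 <= hdist D c x y.
Proof. exact: ln_ge0. Qed.

Lemma hdist_eq0 x y : D x -> D y -> hdist D c x y = 0 <-> x = y.
Proof.
move=> Dx Dy; split => [/eqP|->]; last first.
  by rewrite /hdist mdistxx mul0r mulr0 addr0 ln1.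
(* As division by zero yields zero, a vanishing quotient forces [mdist x y = 0] only once the
   denominator is known to be nonzero. *)
have dxy : Num.sqrt (d x * d y) != 0.
  by rewrite gt_eqF// sqrtr_gt0 mulr_gt0 ?bdist_gt0.
rewrite ln_eq0// -subr_eq0 addrAC subrr add0r !mulf_eq0 invr_eq0.
rewrite (gt_eqF c0) (negbTE dxy) orbF /= => /eqP xy.
exact: mdist_positivity xy.
Qed.

Lemma hdist_sym x y : hdist D c x y = hdist D c y x.
Proof. by rewrite /hdist metric_sym [bdist D x * _]mulrC. Qed.

Lemma hdist_triangle x y z : D x -> D y -> D z ->
  hdist D c x z <= hdist D c x y + hdist D c y z.
Proof.
move=> /bdist_gt0 dx /bdist_gt0 dy /bdist_gt0 dz.
rewrite -lnM ?posrE// ler_ln ?posrE ?mulr_gt0//.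
(* With the roots split, the square roots of the three distances serve as [a], [b], [e], and the
   bounds on [b ^+ 2] become Lipschitz bounds. *)
rewrite !sqrtrM ?(ltW dx) ?(ltW dy)//.
apply: hdist_expand_triangle;
  rewrite ?sqrtr_gt0 ?mdist_ge0 ?sqr_sqrtr ?(ltW dx) ?(ltW dy) ?(ltW dz)//.
- exact: metric_triangle.
- by rewrite metric_sym; exact: set_dist_lipschitz.
- exact: set_dist_lipschitz.
Qed.

Lemma hdist_is_metric : is_metric_on D (hdist D c).
Proof.
split=> [x y _ _|||].
- exact: hdist_ge0.
- exact: hdist_eq0.
- by move=> x y _ _; exact: hdist_sym.
- exact: hdist_triangle.
Qed.

End HdistMetric.

Section UnitInterval.
Context (R : realType).

Let I : set R^o := ball (0 : R^o) 1.

Lemma unit_intervalE (x : R) : I x <-> `|x| < 1.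
Proof. by rewrite /I /ball /= sub0r normrN. Qed.

(** In a normed space the closure of an open ball is the closed ball, so the boundary is the
    sphere. *)
Lemma boundary_unit_interval (x : R) : boundary I x <-> `|x| = 1.
Proof.
rewrite /boundary closure_ballE closed_ballE// /closed_ball_.
have /interior_id -> : open I by exact: ball_open.
split=> [[/= x1 nIx]|x1].
  apply/eqP; rewrite eq_le; move: x1; rewrite sub0r normrN => -> /=.
  by rewrite leNgt; apply/negP => /unit_intervalE.
split=> /=; first by rewrite sub0r normrN x1.
by move=> /unit_intervalE; rewrite x1 ltxx.
Qed.

(** The reverse triangle inequality gives the lower bound; the endpoint on the same side of 0 as [x]
    gives the upper one. *)
Lemma bdist_unit_interval (x : R) : `|x| < 1 -> bdist I x = 1 - `|x|.
Proof.
move=> x1; apply/eqP; rewrite eq_le; apply/andP; split; last first.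
  apply: le_set_dist; first by exists 1; apply/boundary_unit_interval/normr1.
  move=> y /boundary_unit_interval <-; rewrite /mdist /=.
  exact: lerB_dist.
have [x0|x0] := leP 0 x.
  apply: le_trans (set_dist_le (x : R^o) 1 _ _) _.
    exact/boundary_unit_interval/normr1.
  by rewrite /mdist /= ger0_norm//; move: x1; rewrite ger0_norm//; lra.
apply: le_trans (set_dist_le (x : R^o) (-1) _ _) _.
  by apply/boundary_unit_interval; rewrite normrN1.
by move: x1; rewrite /mdist /= ltr0_norm// => ?; rewrite ler0_norm; lra.
Qed.

Lemma hdist_unit_interval_not_metric (c : R) :
  0 < c -> c < 2 -> ~ is_metric_on I (hdist I c).
Proof.
move=> c0 c2 [_ _ _ tri].
(* Here [c = 2 - 4 * s], so [c * (1 + s) = 2 - 2 * s - 4 * s ^+ 2 < 2]. *)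
pose s : R := (2 - c) / 4.
have s0 : 0 < s by rewrite /s; lra.
have s1 : s < 1 by rewrite /s; lra.
have cs : c * (1 + s) < 2 by rewrite /s; nra.
(* The points [- u] and [u] lie at distance [s ^+ 2] from the boundary, so every square root below
   is explicit. *)
have [u uE] : exists u : R, u = 1 - s ^+ 2 by exists (1 - s ^+ 2).
have u0 : 0 < u by rewrite uE; nra.
have u1 : u < 1 by rewrite uE; nra.
have nu : `|u| = u by rewrite gtr0_norm.
have := tri (- u) 0 u.
rewrite !unit_intervalE normrN normr0 nu => /(_ u1 ltr01 u1).
rewrite /hdist !bdist_unit_interval ?normrN ?normr0 ?nu//.
have -> : 1 - u = s ^+ 2 by rewrite uE; ring.
rewrite subr0 mulr1 mul1r -expr2 !sqrtr_sqr !ger0_norm ?sqr_ge0 ?(ltW s0)//.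
rewrite /mdist /= !opprK subr0 add0r nu gtr0_norm ?addr_gt0//.
have us0 : 0 < c * (u / s) by rewrite mulr_gt0// divr_gt0.
have uus0 : 0 < c * ((u + u) / s ^+ 2).
  by rewrite mulr_gt0// divr_gt0 ?exprn_gt0 ?addr_gt0.
rewrite -lnM ?ler_ln ?posrE ?mulr_gt0 ?addr_gt0//.
apply/negP; rewrite -ltNge -subr_gt0.
(* Factoring [u = (1 - s) * (1 + s)] exhibits the gap as a product of positive factors. *)
have -> : 1 + c * ((u + u) / s ^+ 2) - (1 + c * (u / s)) * (1 + c * (u / s))
    = c * u * ((1 - s) * (2 - c * (1 + s)) / s ^+ 2).
  by rewrite uE; field; rewrite gt_eqF.
by rewrite !mulr_gt0// ?invr_gt0 ?exprn_gt0// subr_gt0.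
Qed.

End UnitInterval.

Theorem theorem1p1 (R : realType) :
  (forall (X : metricType R) (D : set X),
     open D -> D !=set0 -> boundary D !=set0 ->
     forall c : R, 2 <= c -> is_metric_on D (hdist D c)) /\
  (forall c : R, 0 < c -> c < 2 ->
     exists (X : metricType R) (D : set X),
       [/\ open D, D !=set0, boundary D !=set0
         & ~ is_metric_on D (hdist D c)]).
Proof.
split=> [X D oD _ bD0 c c2|c c0 c2]; first exact: hdist_is_metric.
exists R^o, (ball (0 : R^o) 1); split.
- exact: ball_open.
- by exists 0; apply: ballxx.
- by exists 1; apply/boundary_unit_interval/normr1.
- exact: hdist_unit_interval_not_metric.
Qed.
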